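(* Let $n\ge 1$ be an integer, let $U\subseteq\mathbb{R}^2$ be open, and let $F:U\to\mathbb{R}$, $(x,y)\mapsto F(x,y)$, be $n$ times continuously differentiable. Suppose the equation $F(x,y)=0$ defines $y$ as an implicit function of $x$, i.e. $y=y(x)$ is a differentiable real-valued function on an open interval $J\subseteq\mathbb{R}$ with $(x,y(x))\in U$ and $F(x,y(x))=0$ for all $x\in J$, and suppose $F_y(x,y(x))\ne 0$ for all $x\in J$. Then for every $x\in J$, \[ \frac{d^ny}{dx^n}=\sum_{k=1}^{2n-1}(-1)^k F_y^{-k}\,\boldsymbol{I}_{n,k}, \] where the right-hand side is evaluated at the point $(x,y(x))$.
   Context: Subscripts on $F$ denote partial derivatives: $F_x=\partial F/\partial x$, $F_y=\partial F/\partial y$, etc.; $F_y^{-k}$ means $(F_y)^{-k}$. Definition of $\boldsymbol{I}_{n,k}$: for integers $n\ge1$, $k\ge1$, consider the set $\{1,2,\dots,n+k-1\}$. The elements $1,\dots,n$ are called small and the elements $n+1,\dots,n+k-1$ are called large. Let $\Sigma_{n,k}$ be the set of all set partitions of $\{1,2,\dots,n+k-1\}$ into exactly $k$ (nonempty) blocks such that no large element forms a singleton block. For a block $B$ let $s(B)$ be the number of small elements in $B$ and $\ell(B)$ the number of large elements in $B$. Then \[ \boldsymbol{I}_{n,k}=\sum_{\pi\in\Sigma_{n,k}}\ \prod_{B\in\pi}\frac{\partial^{\,s(B)+\ell(B)}F}{\partial x^{s(B)}\,\partial y^{\ell(B)}} \] (small elements correspond to $x$-derivatives and large elements to $y$-derivatives).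 An empty sum is $0$. *)

(* Defs.v *)
(* Real analysis is that of Stdlib's R with Coquelicot; finite sets, set
   partitions and big operators are those of MathComp, which sees R as a real
   field through Rstruct. *)
From Stdlib Require Export Reals.
From Coquelicot Require Export Coquelicot.
From mathcomp Require Export all_boot all_order all_algebra.
From mathcomp Require Export Rstruct.

Set Implicit Arguments.
Unset Strict Implicit.
Unset Printing Implicit Defensive.

(* The ground set {1, ..., n + k - 1} is 'I_(n + k - 1), the ordinal i standing
   for the element i + 1: thus i is small when i < n and large when n <= i. *)

Definition nb_small (n m : nat) (B : {set 'I_m}) : nat :=
  #|[set i in B | (i < n)%N]|.

Definition nb_large (n m : nat) (B : {set 'I_m}) : nat :=
  #|[set i in B | (n <= i)%N]|.

Definition Sigma (n k : nat) : {set {set {set 'I_(n + k - 1)}}} :=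
  [set P : {set {set 'I_(n + k - 1)}} |
    [&& partition P [set: 'I_(n + k - 1)],
        #|P| == k
      & [forall i : 'I_(n + k - 1), (n <= i)%N ==> ([set i] \notin P)]]].

(* partial_derive s l F is F differentiated l times in its second variable and
   then s times in its first one. *)
Definition I_poly (F : R -> R -> R) (n k : nat) (x y : R) : R :=
  (\sum_(P in Sigma n k)
     \prod_(B in P) partial_derive (nb_small n B) (nb_large n B) F x y)%R.

(* ex_diff_n F n x y: all iterated partial derivatives of F of order at most n,
   in any order of differentiation, exist and are jointly continuous at (x, y).
   Values of F outside U are irrelevant, U being open. *)
Definition C_n_on (n : nat) (U : R * R -> Prop) (F : R -> R -> R) : Prop :=
  forall x y : R, U (x, y) -> ex_diff_n F n x y.

(* Main.v *)
(* Give a block with s small and l large elements the weight F_{s,l}, except that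
   an empty block and a lone large element get weight 0, and let
     G = sum F_{i,j} s^i t^j / (i! j!)  over  (i,j) <> (0,0), (0,1).
   Distinguishing a block of a partition corresponds to G^k = G * G^(k-1), whence
   I_{n,k} = (n!/k) [s^n t^(k-1)] G^k.  Along the curve y' = - F_x / F_y, and the
   derivative in x of G is
     d_s G + y' d_t G - F_x - (F_xy + y' F_yy) t.
   When sum_k (-1)^k F_y^(-k) (n!/k) [s^n t^(k-1)] G^k is differentiated, the
   term d_s G yields the same sum for n + 1, and all the other terms, together
   with the derivative of F_y^(-k), telescope in k.  The theorem follows by
   induction on n. *)
Require Import Defs.
From mathcomp Require Import ring zify.

Set Implicit Arguments.
Unset Strict Implicit.
Unset Printing Implicit Defensive.

Import Order.TTheory GRing.Theory Num.Theory.

Local Open Scope ring_scope.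

(** * The chain rule along the curve *)

(** An x-partial that exists nearby and is continuous at the point, together with a y-partial at the
    point, gives differentiability. The new y-derivative has to be commuted past the i
    x-derivatives, which uses regularity in a neighbourhood. *)
Lemma is_derive_partial_curve (F : R -> R -> R) (n i j : nat) (y : R -> R)
    (x r : R) :
  locally (x, y x) (fun u => ex_diff_n F n u.1 u.2) -> (i + j < n)%N ->
  is_derive y x r ->
  is_derive (fun t => partial_derive i j F t (y t)) x
    (partial_derive i.+1 j F x (y x) + r * partial_derive i j.+1 F x (y x)).
Proof.
move=> hF /ssrnat.ltP ij_n dy.
have hFx : ex_diff_n F n x (y x) := locally_singleton _ _ hF.
have dF : differentiable_pt_lim (partial_derive i j F) x (y x)
   (partial_derive i.+1 j F x (y x)) (partial_derive i j.+1 F x (y x)).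
  apply/filterdiff_differentiable_pt_lim.
  apply: (is_derive_filterdiff (partial_derive i j F) x (y x)
    (fun u v => partial_derive i.+1 j F u v)).
  - apply: filter_imp hF => u hu.
    apply: (Derive_correct (fun z => partial_derive i j F z u.2)).
    exact: ex_diff_n_ex_deriv_inf_1 hu.
  - rewrite -Derive_partial_derive.
      apply: (Derive_correct (fun z => partial_derive i j F x z)).
      exact: ex_diff_n_ex_deriv_inf_2 hFx.
    apply/locally_2d_locally; apply: filter_imp hF => u.
    by apply: ex_diff_n_m; rewrite -plus_n_Sm.
  - apply/(continuity_2d_pt_filterlim (fun u v => partial_derive i.+1 j F u v)).
    exact: (ex_diff_n_continuity_inf_1 _ _ _ ij_n).
apply/is_derive_Reals.
have /is_derive_Reals dy' := dy.
have := derivable_pt_lim_comp_2d _ _ _ _ _ _ _ _ dF (derivable_pt_lim_id x) dy'.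
by rewrite !RplusE !RmultE mulr1 [r * _]mulrC.
Qed.

(** * Sums over set partitions *)

Section PartitionSums.
Variables (R : comNzRingType) (T : finType) (W : {set T} -> R).
Implicit Types (A B : {set T}) (P Q : {set {set T}}).

Definition partition_sum A k : R :=
  \sum_(P : {set {set T}} | partition P A && (#|P| == k)) \prod_(B in P) W B.

Lemma partition_setDN A B Q :
  B != set0 -> partition Q (A :\: B) -> B \notin Q.
Proof.
move=> B0 QAB; apply/negP => BQ; have := partitionS QAB BQ.
rewrite subsetD -setI_eq0 setIid => /andP[_ /eqP B00].
by rewrite B00 eqxx in B0.
Qed.

(* Both sides sum over the partitions with a distinguished block B. *)
Lemma partition_sumS A k :
  partition_sum A k.+1 *+ k.+1 =
  \sum_(B : {set T} | (B \subset A) && (B != set0))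
     W B * partition_sum (A :\: B) k.
Proof.
rewrite -sumrMnl (eq_bigr (fun P => \sum_(B in P) \prod_(C in P) W C)); last first.
  by move=> P /andP[_ /eqP cP]; rewrite sumr_const cP.
rewrite (exchange_big_dep (fun B => (B \subset A) && (B != set0))) /=; last first.
  move=> P B /andP[PA _] BP.
  by rewrite (partitionS PA BP) (partition_neq0 PA BP).
apply: eq_bigr => B /andP[BA B0]; rewrite big_distrr /=.
(* Removing the distinguished block B is a bijection onto the partitions of [A :\: B] into k
   blocks. *)
rewrite (reindex_onto (fun Q => B |: Q) (fun P => P :\ B)) /=; last first.
  by move=> P /andP[_ BP]; rewrite setD1K.
apply: eq_big => [Q|Q /andP[/andP[/andP[_ _] _] /eqP QB]]; last first.
  have BQ : B \notin Q by rewrite -QB !inE eqxx.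
  by rewrite big_setU1.
rewrite setU11 andbT; apply/idP/idP.
  move=> /andP[/andP[BQA cQ] /eqP QB].
  have BQ : B \notin Q by rewrite -QB !inE eqxx.
  have := partitionD1 BQA (setU11 B Q); rewrite QB => ->.
  by move: cQ; rewrite cardsU1 BQ eqSS.
move=> /andP[QAB /eqP cQ]; have BQ := partition_setDN B0 QAB.
rewrite cardsU1 BQ cQ eqxx andbT (setU1K BQ) eqxx andbT.
have dBA : [disjoint B & A :\: B].
  by rewrite -setI_eq0 setIDA setIC -setIDA setDv setI0.
have BUA : B :|: (A :\: B) = A by rewrite -{1}(setIidPr BA) setID.
by have := partitionU1 QAB B0 dBA; rewrite BUA => ->.
Qed.
End PartitionSums.

Lemma sum_subset_card (R : nzSemiRingType) (T : finType) (D : {set T})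
    (f : nat -> R) :
  \sum_(X : {set T} | X \subset D) f #|X| =
  \sum_(a < #|D|.+1) f a *+ 'C(#|D|, a).
Proof.
rewrite (partition_big (fun X : {set T} => inord #|X| : 'I_(#|D|.+1)) predT) //=.
apply: eq_bigr => a _; rewrite -cards_draws -sumr_const.
apply: eq_big => [X|X /andP[XD /eqP <-]]; rewrite ?inE.
  case XD: (X \subset D) => //=.
  by rewrite -val_eqE /= inordK // ltnS subset_leq_card.
by rewrite inordK // ltnS subset_leq_card.
Qed.

(** B corresponds to the pair of its traces on S and on the complement of S, which are chosen
    independently. *)
Lemma sum_subset_card2 (R : nzSemiRingType) (T : finType) (S A : {set T})
    (f : nat -> nat -> R) :
  \sum_(B : {set T} | B \subset A) f #|B :&: S| #|B :\: S| =
  \sum_(a < #|A :&: S|.+1) \sum_(b < #|A :\: S|.+1)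
    f a b *+ 'C(#|A :\: S|, b) *+ 'C(#|A :&: S|, a).
Proof.
transitivity (\sum_(X : {set T} | X \subset A :&: S)
    \sum_(Y : {set T} | Y \subset A :\: S) f #|X| #|Y|).
  rewrite pair_big /=.
  rewrite (reindex_onto (fun B => (B :&: S, B :\: S))
    (fun XY => XY.1 :|: XY.2)) /=.
    apply: eq_bigl => B; rewrite setID eqxx andbT.
    rewrite -{1}(setID B S) subUset subsetI subsetIr andbT subsetD.
    by rewrite -setI_eq0 setDE -setIA (setIC (~: S)) setICr setI0 eqxx andbT.
  move=> [X Y] /= /andP[]; rewrite subsetI subsetD.
  move=> /andP[_ /setIidPl XS] /andP[_ YS].
  have XDS : X :\: S = set0 by rewrite -XS setDE -setIA setICr setI0.
  have YIS : Y :&: S = set0 by apply/eqP; rewrite setI_eq0.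
  have YDS : Y :\: S = Y by apply/setDidPl.
  by rewrite setIUl setDUl XDS YIS YDS XS setU0 set0U.
rewrite (sum_subset_card _
  (fun a => \sum_(Y : {set T} | Y \subset A :\: S) f a #|Y|)).
by apply: eq_bigr => a _; rewrite sum_subset_card sumrMnl.
Qed.

Lemma coef2M (R : comNzRingType) (p q : {poly {poly R}}) i j :
  (p * q)`_i`_j = \sum_(a < i.+1) \sum_(b < j.+1) p`_a`_b * q`_(i - a)`_(j - b).
Proof. by rewrite coefM coef_sum; apply: eq_bigr => a _; rewrite coefM. Qed.

(** The exponential formula in two variables, by induction on k: [partition_sumS] matches G^(k+1) =
    G * G^k, the binomials being absorbed by the factorials. Only the coefficients of G up to the
    size of A matter, so G may be truncated. *)
Lemma partition_sum_coef (R : numFieldType) (T : finType) (S A : {set T})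
    (v : nat -> nat -> R) (G : {poly {poly R}}) k :
  v 0 0 = 0 ->
  (forall a b, (a <= #|A :&: S|)%N -> (b <= #|A :\: S|)%N ->
     G`_a`_b = v a b / (a`! * b`!)%:R) ->
  partition_sum (fun B => v #|B :&: S| #|B :\: S|) A k =
    (#|A :&: S|`! * #|A :\: S|`!)%:R / k`!%:R * (G ^+ k)`_#|A :&: S|`_#|A :\: S|.
Proof.
move=> v00; have f0 m : m`!%:R != 0 :> R by rewrite pnatr_eq0 -lt0n fact_gt0.
elim: k A => [|k IHk] A hG.
  rewrite expr0 coef1 divr1 /partition_sum.
  have [->|A0] := eqVneq A set0.
    rewrite set0I set0D cards0 fact0 muln1 mul1r coef1 /=.
    rewrite (big_pred1 set0) ?big_set0 // => P.
    rewrite partition_set0 cards_eq0; exact: andbb.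
  rewrite big_pred0 => [|P]; last first.
    apply/negP => /andP[PA]; rewrite cards_eq0 => /eqP P0.
    by move: PA; rewrite P0 /partition /cover big_set0 eq_sym (negPf A0).
  have : (#|A :&: S| + #|A :\: S|)%N != 0%N by rewrite cardsID cards_eq0.
  case: #|A :&: S| => [|s] /=; last by rewrite coef0 mulr0.
  by rewrite coef1 add0n => /negPf ->; rewrite mulr0.
apply: (@mulIf _ k.+1%:R); first by rewrite pnatr_eq0.
rewrite mulr_natr partition_sumS.
set s := #|A :&: S|; set l := #|A :\: S|.
(* The contribution of a distinguished block with a elements in S and b outside, the other k blocks
   being summed by induction. *)
pose f a b := v a b * (((s - a)`! * (l - b)`!)%:R / k`!%:R *
                        (G ^+ k)`_(s - a)`_(l - b)).
transitivity (\sum_(B : {set T} | B \subset A) f #|B :&: S| #|B :\: S|).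
  (* The empty B may be included, as [v 0 0 = 0]. *)
  rewrite [RHS](bigID (fun B => B != set0)) /= [X in _ + X]big1 ?addr0; last first.
    move=> B /andP[_]; rewrite negbK => /eqP ->.
    by rewrite set0I set0D cards0 /f v00 mul0r.
  apply: eq_bigr => B /andP[BA _].
  have eI : #|(A :\: B) :&: S| = (s - #|B :&: S|)%N.
    rewrite -cardsDS ?setSI //; congr #|pred_of_set _|; apply/setP => x.
    by rewrite !inE; case: (x \in B); case: (x \in A); case: (x \in S).
  have eD : #|(A :\: B) :\: S| = (l - #|B :\: S|)%N.
    rewrite -cardsDS ?setSD //; congr #|pred_of_set _|; apply/setP => x.
    by rewrite !inE; case: (x \in B); case: (x \in A); case: (x \in S).
  rewrite IHk; first by rewrite eI eD.
  move=> a b; rewrite eI eD => ha hb; apply: hG.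
    exact: leq_trans ha (leq_subr _ _).
  exact: leq_trans hb (leq_subr _ _).
rewrite sum_subset_card2 -/s -/l exprS coef2M !big_distrr big_distrl /=.
apply: eq_bigr => a _; rewrite !big_distrr big_distrl /=.
apply: eq_bigr => b _.
have sa : (a <= s)%N by rewrite -ltnS.
have lb : (b <= l)%N by rewrite -ltnS.
rewrite (hG a b sa lb) -[_ *+ 'C(s, a)]mulr_natr -[_ *+ 'C(l, b)]mulr_natr /f.
have := congr1 (fun m => m%:R : R) (bin_fact sa).
have := congr1 (fun m => m%:R : R) (bin_fact lb).
rewrite factS !natrM => <- <-.
have := f0 a; have := f0 b; have := f0 k.
have : k.+1%:R != 0 :> R by rewrite pnatr_eq0.
move: k.+1%:R k`!%:R b`!%:R a`!%:R (s - a)`!%:R (l - b)`!%:R.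
move: 'C(s, a)%:R 'C(l, b)%:R.
move=> E0 F0 K1 K0 B0 A0 C0 D0 k1 k0 b0 a0; field.
by rewrite k1 k0 b0 a0.
Qed.

(** * The generating polynomial of the derivatives *)

Section WeightedOrder.
Variables (R : comNzRingType) (al be : nat).
Implicit Types (p q : {poly {poly R}}) (m : nat).

(** The order at the origin when the outer variable s has weight [al] and the inner variable t has
    weight [be]. Weights (1,1) control truncation; weights (2,1) bound the range of k. *)
Definition order_ge m p := forall i j, (al * i + be * j < m)%N -> p`_i`_j = 0.

Lemma order_geD m p q : order_ge m p -> order_ge m q -> order_ge m (p + q).
Proof. by move=> hp hq i j ij; rewrite !coefD hp ?hq ?addr0. Qed.

Lemma order_geM m m' p q :
  order_ge m p -> order_ge m' q -> order_ge (m + m') (p * q).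
Proof.
move=> hp hq i j ij; rewrite coef2M big1 // => a _; rewrite big1 // => b _.
have [ab|ab] := ltnP (al * a + be * b) m; first by rewrite hp ?mul0r.
rewrite hq ?mulr0 //; have := ltn_ord a; have := ltn_ord b; nia.
Qed.

Lemma order_geX k m p : order_ge m p -> order_ge (k * m) (p ^+ k).
Proof.
move=> hp; elim: k => [|k IHk]; first by move=> i j; rewrite mul0n.
by rewrite exprS mulSn; apply: order_geM.
Qed.

(** For k > 0, p^k - q^k is p - q times a sum of products of k - 1 factors p or q, each factor
    adding 1 to the order. *)
Lemma order_ge_subX k m p q : order_ge 1 p -> order_ge 1 q ->
  order_ge m.+1 (p - q) -> order_ge (m + k) (p ^+ k - q ^+ k).
Proof.
move=> hp hq hpq; elim: k => [|k IHk].
  by move=> i j _; rewrite !expr0 subrr !coef0.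
have -> : p ^+ k.+1 - q ^+ k.+1 = p * (p ^+ k - q ^+ k) + (p - q) * q ^+ k.
  by rewrite !exprS; ring.
apply: order_geD; first by have := order_geM hp IHk; rewrite add1n addnS.
have := order_geM hpq (order_geX (k := k) hq).
by rewrite muln1 addSnnS.
Qed.

End WeightedOrder.

Section Egf.
Variable R : numFieldType.
Implicit Types (w : nat -> nat -> R).

(* cut01 discards the two weights F and F_y, i.e. those of an empty block and of
   a block reduced to one large element. *)
Definition cut01 w i j := if (i == 0%N) && (j <= 1)%N then 0 else w i j.

(* Truncated at total degree N, as F has no derivatives of higher order. *)
Definition egf N w : {poly {poly R}} :=
  \poly_(i < N.+1) \poly_(j < N.+1 - i) (cut01 w i j / (i`! * j`!)%:R).

Lemma coef_egf N w i j :
  (egf N w)`_i`_j =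
  if (i + j <= N)%N then cut01 w i j / (i`! * j`!)%:R else 0.
Proof.
rewrite coef_poly; case: ltnP => hi.
  by rewrite coef_poly; congr (if _ then _ else _); lia.
by rewrite coef0; case: leqP => //; lia.
Qed.

Lemma order_ge_egf N w : order_ge 1 1 1 (egf N w).
Proof.
move=> i j; rewrite !mul1n => ij; rewrite coef_egf /cut01.
have [-> ->] : i = 0%N /\ j = 0%N by lia.
by rewrite mul0r.
Qed.

(** The monomials 1 and t discarded by [cut01] are exactly those of weight below 2. *)
Lemma order_ge_egf21 N w : order_ge 2 1 2 (egf N w).
Proof.
move=> i j ij; rewrite coef_egf /cut01.
have [-> hj] : i = 0%N /\ (j <= 1)%N by lia.
by rewrite hj mul0r if_same.
Qed.

Lemma order_ge_sub_egf N n w : (n <= N)%N ->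
  order_ge 1 1 n.+1 (egf N w - egf n w).
Proof.
move=> nN i j ij; rewrite !coefB !coef_egf !ifT ?subrr //; lia.
Qed.

Lemma coef_egfX_stable N n w k i j : (n <= N)%N -> (i + j < n + k)%N ->
  (egf N w ^+ k)`_i`_j = (egf n w ^+ k)`_i`_j.
Proof.
move=> nN ij; apply/eqP; rewrite -subr_eq0 -!coefB; apply/eqP.
apply: (order_ge_subX (k := k) (order_ge_egf N w) (order_ge_egf n w)
  (order_ge_sub_egf w nN)).
by rewrite !mul1n.
Qed.

(** For s^n t^(k-1) the condition reads k >= 2n, whence the upper limit 2n - 1 of the sum. *)
Lemma coef_egfX_eq0 N w k i j : (2 * i + j < 2 * k)%N -> (egf N w ^+ k)`_i`_j = 0.
Proof.
move=> h; apply: (order_geX (k := k) (order_ge_egf21 N w)); lia.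
Qed.

End Egf.

(* The truncation at degree n is harmless: k nonempty blocks share n + k - 1
   elements, so none has more than n. *)
Lemma I_poly_egf (F : R -> R -> R) n k x y : (1 <= k)%N ->
  I_poly F n k x y = n`!%:R / k%:R *
    (egf n (fun i j => partial_derive i j F x y) ^+ k)`_n`_k.-1.
Proof.
move=> k0; set w := fun i j : nat => _.
pose S := [set i : 'I_(n + k - 1) | (i < n)%N].
have cI : #|[set: 'I_(n + k - 1)] :&: S| = n.
  rewrite setTI -sum1_card.
  rewrite (eq_bigl (fun i : 'I_(n + k - 1) => (i < n)%N)); last first.
    by move=> i; rewrite inE.
  rewrite -(big_ord_widen _ (fun=> 1%N)) ?sum1_card ?card_ord //; lia.
have cD : #|[set: 'I_(n + k - 1)] :\: S| = k.-1.
  apply/eqP; rewrite -(eqn_add2l n) -{1}cI cardsID cardsT card_ord; lia.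
have sE (B : {set 'I_(n + k - 1)}) : #|B :&: S| = nb_small n B.
  by apply: eq_card => i; rewrite !inE.
have lE (B : {set 'I_(n + k - 1)}) : #|B :\: S| = nb_large n B.
  by apply: eq_card => i; rewrite !inE -leqNgt andbC.
transitivity
  (partition_sum (fun B => cut01 w #|B :&: S| #|B :\: S|) setT k); last first.
  (* This truncation covers all block sizes a <= n, b <= k - 1; it is then lowered to n by
     stability. *)
  rewrite (partition_sum_coef (G := egf (n + k.-1) w)) //; last first.
    by rewrite cI cD => a b ha hb; rewrite coef_egf ifT //; lia.
  rewrite cI cD (coef_egfX_stable (n := n)) ?leq_addr //; last lia.
  congr (_ * _); case: k k0 {S cI cD sE lE} => //= k _.
  rewrite factS !natrM.
  have : k`!%:R != 0 :> R by rewrite pnatr_eq0 -lt0n fact_gt0.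
  have : k.+1%:R != 0 :> R by rewrite pnatr_eq0.
  move: k`!%:R k.+1%:R n`!%:R => a b c b0 a0; field.
  by rewrite a0 b0.
rewrite /I_poly /partition_sum /Sigma.
(* A partition with a large singleton has product 0; in the others [cut01] alters no block, since a
   nonempty block without small elements and with at most one large one is a large singleton. *)
rewrite [RHS](bigID (fun P : {set {set 'I_(n + k - 1)}} =>
  [forall i : 'I_(n + k - 1), (n <= i)%N ==> ([set i] \notin P)])) /=.
rewrite [X in _ = _ + X]big1 ?addr0.
  apply: eq_big => [P|P]; first by rewrite inE andbA.
  rewrite inE => /and3P[Ppart _ /forallP Plarge]; apply: eq_bigr => B BP.
  rewrite sE lE /cut01; case: ifP => // /andP[/eqP s0 l1].
  have : (#|B| <= 1)%N by rewrite -(cardsID S B) sE lE s0.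
  have := partition_neq0 Ppart BP; rewrite -card_gt0 => B0 B1.
  have /eqP/cards1P[i Bi] : #|B| = 1%N by lia.
  have := Plarge i; rewrite -Bi BP implybF => in'.
  move/eqP: s0; rewrite -sE cards_eq0 => /eqP/setP/(_ i).
  by rewrite Bi !inE eqxx ltnNge in'.
move=> P /andP[_ /forallPn[i]]; rewrite negb_imply negbK => /andP[hi iP].
rewrite (bigD1 [set i]) //= sE lE /cut01.
have -> : nb_small n [set i] = 0%N.
  apply/eqP; rewrite cards_eq0; apply/eqP/setP => j; rewrite !inE.
  by case: eqP => // ->; rewrite ltnNge hi.
have -> /= : (nb_large n [set i] <= 1)%N.
  apply: leq_trans (eq_leq (cards1 i)); apply/subset_leq_card/subsetP => j.
  by rewrite !inE => /andP[].
by rewrite mul0r.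
Qed.

(** * Differentiation of the coefficients *)

Lemma is_derive_addR (f g : R -> R) (x df dg : R) :
  is_derive f x df -> is_derive g x dg ->
  is_derive (fun t => f t + g t) x (df + dg).
Proof. exact: is_derive_plus. Qed.

Lemma is_derive_mulR (f g : R -> R) (x df dg : R) :
  is_derive f x df -> is_derive g x dg ->
  is_derive (fun t => f t * g t) x (df * g x + f x * dg).
Proof. by move=> hf hg; apply: is_derive_mult => // a b; apply: mulrC. Qed.

Lemma is_derive_sumR (I : Type) (s : seq I) (P : pred I) (f : I -> R -> R)
    (df : I -> R) (x : R) :
  (forall i, P i -> is_derive (f i) x (df i)) ->
  is_derive (fun t => \sum_(i <- s | P i) f i t) x (\sum_(i <- s | P i) df i).
Proof.
move=> hf; elim: s => [|i s IHs].
  apply: (is_derive_ext (fun=> 0 : R)) => [t|]; first by rewrite big_nil.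
  by rewrite big_nil; apply: is_derive_const.
rewrite big_cons; case: ifP => Pi.
  apply: (is_derive_ext (fun t => f i t + \sum_(i <- s | P i) f i t)) => [t|].
    by rewrite big_cons Pi.
  by apply: is_derive_addR => //; apply: hf.
apply: is_derive_ext IHs => t; by rewrite big_cons Pi.
Qed.

Definition is_derive_poly (P : R -> {poly {poly R}}) x (dP : {poly {poly R}}) :=
  forall i j, is_derive (fun t => (P t)`_i`_j) x dP`_i`_j.

Lemma is_derive_polyM P Q x dP dQ :
  is_derive_poly P x dP -> is_derive_poly Q x dQ ->
  is_derive_poly (fun t => P t * Q t) x (dP * Q x + P x * dQ).
Proof.
move=> hP hQ i j; rewrite !coefD !coef2M -big_split /=.
apply: is_derive_ext => [t|]; first by rewrite coef2M.
apply: is_derive_sumR => a _; rewrite -big_split /=.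
by apply: is_derive_sumR => b _; apply: is_derive_mulR.
Qed.

Lemma is_derive_polyX P x dP k : is_derive_poly P x dP ->
  is_derive_poly (fun t => P t ^+ k) x (P x ^+ k.-1 * dP *+ k).
Proof.
move=> hP; elim: k => [|k IHk].
  move=> i j; rewrite mulr0n !coef0.
  apply: (is_derive_ext (fun=> (1 : {poly {poly R}})`_i`_j)) => [t|].
    by rewrite expr0.
  exact: is_derive_const.
move=> i j; have := is_derive_polyM hP IHk i j.
have -> : dP * P x ^+ k + P x * (P x ^+ k.-1 * dP *+ k) =
   P x ^+ k.+1.-1 * dP *+ k.+1.
  case: k {IHk} => [|k] /=; first by rewrite mulr0n mulr0 addr0 mulr1n mulrC.
  by rewrite mulrnAr mulrA -exprS [RHS]mulrS [dP * _]mulrC.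
by apply: is_derive_ext => t; rewrite exprS.
Qed.

Section Deriv2.
Variable R : comNzRingType.
Implicit Types p q : {poly {poly R}}.

(** The derivative in the inner variable t; [deriv] on the outer polynomial is the one in s. *)
Definition deriv2 p := map_poly (@deriv R) p.

Lemma coef_deriv2 p i j : (deriv2 p)`_i`_j = p`_i`_j.+1 *+ j.+1.
Proof. by rewrite coef_map coef_deriv. Qed.

Lemma deriv2M p q : deriv2 (p * q) = deriv2 p * q + p * deriv2 q.
Proof.
apply/polyP => i; rewrite coefD coef_map !coefM /= raddf_sum -big_split /=.
by apply: eq_bigr => a _; rewrite derivM !coef_map.
Qed.

Lemma deriv2X p k : deriv2 (p ^+ k) = p ^+ k.-1 * deriv2 p *+ k.
Proof.
elim: k => [|k IHk].
  apply/polyP => i; rewrite expr0 mulr0n coef_map coef1 coef0.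
  by case: eqP => _ /=; rewrite ?derivC ?deriv0.
rewrite exprS deriv2M IHk; case: k {IHk} => [|k] /=.
  by rewrite mulr0n mulr0 addr0 mulr1n mulrC.
by rewrite mulrnAr mulrA -exprS [RHS]mulrS [deriv2 p * _]mulrC.
Qed.
End Deriv2.

Lemma is_derive_exprVn (p : R -> R) (x dp : R) k :
  is_derive p x dp -> p x != 0 ->
  is_derive (fun t => p t ^- k) x (- k%:R * p x ^- k.+1 * dp).
Proof.
move=> hp /eqP px0.
have hV : is_derive (fun t => (p t)^-1) x (- (p x) ^- 2 * dp).
  have := is_derive_inv _ _ _ hp px0.
  rewrite RdivE RoppE RpowE (_ : - dp / p x ^+ 2 = - (p x) ^- 2 * dp); last first.
    by rewrite !mulNr mulrC.
  by apply: is_derive_ext => t; rewrite RinvE.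
move/eqP: px0 => px0; elim: k => [|k IHk].
  rewrite oppr0 !mul0r; apply: (is_derive_ext (fun=> 1 : R)) => [t|].
    by rewrite expr0 invr1.
  exact: is_derive_const.
have -> : - k.+1%:R * p x ^- k.+2 * dp =
   - p x ^- 2 * dp * p x ^- k + (p x)^-1 * (- k%:R * p x ^- k.+1 * dp).
  rewrite -!exprVn !exprS expr0 -[k.+1]addn1 natrD; ring.
apply: is_derive_ext (is_derive_mulR hV IHk) => t.
by rewrite -!exprVn exprS.
Qed.

(** * One differentiation of the generating polynomial *)

Section Step.
Variables (n : nat) (n_gt0 : (0 < n)%N) (w : nat -> nat -> R -> R) (x r : R).
Hypothesis dw : forall i j, (i + j <= n)%N ->
  is_derive (w i j) x (w i.+1 j x + r * w i j.+1 x).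

Let G t := egf n (fun i j => w i j t).
(** One degree more than G, since differentiating G brings in weights of order n + 1. *)
Let G' := egf n.+1 (fun i j => w i j x).
Let e := w 1 1 x + r * w 0 2 x.

(* In d_s G and d_t G the weights F_x, F_xy and F_yy occur as the derivatives of
   those discarded by cut01; d_egf subtracts them. *)
Definition d_egf : {poly {poly R}} :=
  G'^`() + r%:P%:P * deriv2 G' - (w 1 0 x)%:P%:P - e%:P%:P * 'X%:P.

Lemma coef_d_egf i j :
  d_egf`_i`_j = (G'`_i.+1`_j) *+ i.+1 + r * (G'`_i`_j.+1 *+ j.+1)
     - (if (i == 0%N) && (j == 0%N) then w 1 0 x else 0)
     - (if (i == 0%N) && (j == 1%N) then e else 0).
Proof.
rewrite /d_egf !(coefD, coefN) coef_deriv coefMn !coefCM coef_deriv2.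
congr (_ + _ - _ - _).
  by rewrite coefC; case: eqP => //= _; rewrite ?coefC ?coef0 //; case: eqP.
rewrite coefC; case: eqP => //= _; last by rewrite coef0 mulr0.
by rewrite coefX; case: eqP => _; rewrite ?mulr1 ?mulr0.
Qed.

Lemma is_derive_egf : is_derive_poly G x d_egf.
Proof.
move=> i j; rewrite coef_d_egf /G' !coef_egf.
case: (leqP (i + j) n) => ij; last first.
  rewrite !ifF; try lia.
  rewrite !mul0rn mulr0 subr0 addr0 subr0.
  apply: (is_derive_ext (fun=> 0 : R)) => [t|]; last exact: is_derive_const.
  by rewrite coef_egf ifF //; lia.
have -> : (i.+1 + j <= n.+1)%N by lia.
have -> : (i + j.+1 <= n.+1)%N by lia.
have fn0 m : m`!%:R != 0 :> R by rewrite pnatr_eq0 -lt0n fact_gt0.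
have sn0 m : m.+1%:R != 0 :> R by rewrite pnatr_eq0.
(* The coefficients of 1 and t in G are constantly 0; the corrections in [d_egf] cancel F_x and e
   there. *)
case: (boolP ((i == 0%N) && (j <= 1)%N)) => [/andP[/eqP i0 j1]|nij].
  apply: (is_derive_ext (fun=> 0 : R)) => [t|].
    by rewrite coef_egf /cut01 i0 j1 /= mul0r if_same.
  rewrite i0 /cut01 /=; case: j j1 {ij} => [|[|//]] _ /=.
    rewrite mul0r mul0rn mulr0 addr0 subr0 muln1 divr1 mulr1n subrr.
    exact: is_derive_const.
  rewrite subr0 /= muln1 !mul1n divr1 mulr1n.
  rewrite -[_ *+ 2]mulr_natr divfK ?pnatr_eq0 // subrr; exact: is_derive_const.
apply: (is_derive_ext (fun t => w i j t * (i`! * j`!)%:R^-1)) => [t|].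
  by rewrite coef_egf ij /cut01 (negPf nij).
have -> : cut01 (fun i j => w i j x) i j.+1 = w i j.+1 x.
  by rewrite /cut01 ifF //; lia.
rewrite !ifF; try lia.
rewrite /cut01 /= !subr0.
have -> : w i.+1 j x / (i.+1`! * j`!)%:R *+ i.+1 +
  r * (w i j.+1 x / (i`! * j.+1`!)%:R *+ j.+1) =
  (w i.+1 j x + r * w i j.+1 x) * (i`! * j`!)%:R^-1 + w i j x * 0.
  rewrite -[_ *+ i.+1]mulr_natr -[_ *+ j.+1]mulr_natr !factS !natrM.
  move: (fn0 i) (fn0 j) (sn0 i) (sn0 j).
  move: i`!%:R j`!%:R i.+1%:R j.+1%:R => a b c d a0 b0 c0 d0; field.
  by rewrite a0 b0 c0 d0.
by apply: is_derive_mulR; [apply: dw | apply: is_derive_const].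
Qed.

Let c k i j := (G' ^+ k)`_i`_j.

Lemma coef_GX k : (G x ^+ k)`_n`_k.-1 = c k n k.-1.
Proof.
case: k => [|k]; first by rewrite /c !expr0.
by rewrite /c /G' (coef_egfX_stable (n := n)) // addnS ltnS.
Qed.

(** With G' in place of G, k G^(k-1) times the s- and t-derivatives becomes the derivatives of G'^k.
    The replacement is harmless: the two powers differ in order n + k - 1, and [d_egf] has order at
    least 1. *)
Lemma coef_GX_d_egf k : (1 <= k)%N ->
  (G x ^+ k.-1 * d_egf *+ k)`_n`_k.-1 =
  c k n.+1 k.-1 *+ n.+1 + r * (c k n k *+ k) - (c k.-1 n k.-1 * w 1 0 x) *+ k
   - (e * ('X%:P * G' ^+ k.-1)`_n`_k.-1) *+ k.
Proof.
case: k => //= k _.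
have -> : (G x ^+ k * d_egf *+ k.+1)`_n`_k = (G' ^+ k * d_egf *+ k.+1)`_n`_k.
  rewrite !coefMn; congr (_ *+ _); apply/eqP.
  rewrite -subr_eq0 -!coefB -mulrBl; apply/eqP.
  apply: (@order_geM R 1 1 (n + k) 1); last by rewrite !mul1n addn1.
    apply: order_ge_subX; try exact: order_ge_egf.
    move=> i j ij; apply/eqP; rewrite -oppr_eq0 -!coefN opprB; apply/eqP.
    exact: (order_ge_sub_egf (n := n)).
  move=> i j ij; have [-> ->] : i = 0%N /\ j = 0%N by lia.
  rewrite coef_d_egf /G' !coef_egf /cut01 /= mul0r mul0rn mulr0 muln1 divr1.
  by rewrite mulr1n addr0 subr0 subrr.
rewrite /c.
have -> : G' ^+ k * d_egf *+ k.+1 = (G' ^+ k.+1)^`() +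
   r%:P%:P * deriv2 (G' ^+ k.+1) - (w 1 0 x)%:P%:P * (G' ^+ k) *+ k.+1 -
   e%:P%:P * ('X%:P * (G' ^+ k)) *+ k.+1.
  rewrite deriv_exp deriv2X /= /d_egf; ring.
rewrite !(coefD, coefN) coef_deriv !coefMn !coefCM coef_deriv2.
by rewrite [_ * w 1 0 x]mulrC.
Qed.

End Step.

(** * The sum over k and its derivative *)

(** The right-hand side of the theorem, with I_{n,k} in its coefficient form. *)
Definition implicit_sum n (w : nat -> nat -> R) : R :=
  \sum_(1 <= k < 2 * n)
    (-1) ^+ k * w 0 1 ^- k * (n`!%:R / k%:R * (egf n w ^+ k)`_n`_k.-1).

(** The terms k = 2n and k = 2n + 1 vanish; the range becomes that of n + 1. *)
Lemma implicit_sum_widen n w : (0 < n)%N -> implicit_sum n w =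
  \sum_(1 <= k < 2 * n.+1)
    (-1) ^+ k * w 0 1 ^- k * (n`!%:R / k%:R * (egf n w ^+ k)`_n`_k.-1).
Proof.
move=> n0; rewrite (@big_cat_nat _ _ _ (2 * n)) /=; [|lia|lia].
rewrite [X in _ = _ + X]big_nat_cond [X in _ = _ + X]big1 ?addr0 // => k hk.
by rewrite coef_egfX_eq0 ?mulr0 //; lia.
Qed.

Lemma is_derive_implicit_sum n (w : nat -> nat -> R -> R) (x r : R) :
  (0 < n)%N ->
  (forall i j, (i + j <= n)%N ->
     is_derive (w i j) x (w i.+1 j x + r * w i j.+1 x)) ->
  w 0 1 x != 0 -> r = - w 1 0 x / w 0 1 x ->
  is_derive (fun t => implicit_sum n (fun i j => w i j t)) x
            (implicit_sum n.+1 (fun i j => w i j x)).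
Proof.
move=> n0 dw p0 rE; pose p := w 0 1 x; pose e := w 1 1 x + r * w 0 2 x.
pose G' := egf n.+1 (fun i j => w i j x).
(* The derivative of the k-th term by the product rule, e being the derivative of F_y along the
   curve. *)
pose dt k := (-1) ^+ k *
  (- k%:R * p ^- k.+1 * e * (n`!%:R / k%:R * (G' ^+ k)`_n`_k.-1) +
   p ^- k * (n`!%:R / k%:R *
     (egf n (fun i j => w i j x) ^+ k.-1 * d_egf n w x r *+ k)`_n`_k.-1)).
have -> : implicit_sum n.+1 (fun i j => w i j x) = \sum_(1 <= k < 2 * n.+1) dt k.
  apply/esym/eqP; rewrite -subr_eq0 -sumrB; apply/eqP.
  (* In the k-th difference, - f k is the two corrections in [d_egf], while f (k+1) is the
     derivative of F_y^(-k) plus the t-derivative term, by r = - F_x / F_y. *)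
  pose f k := n`!%:R * (-1) ^+ k * p ^- k * (e * ('X%:P * G' ^+ k.-1)`_n`_k.-1
     + w 1 0 x * (G' ^+ k.-1)`_n`_k.-1).
  rewrite (telescope_sumr_eq f); [|lia|].
    (* As n > 0, neither t nor 1 contains s^n. *)
    have -> : f 1%N = 0.
      rewrite /f /= expr0 mulr1 coefC coef1 gtn_eqF //= !coef0 !mulr0 addr0.
      by rewrite mulr0.
    (* The upper end involves G'^(2n+1) at s^n t^(2n) and s^n t^(2n+1), of weights 4n and 4n + 1,
       below 4n + 2. *)
    rewrite subr0 /f mulnS /= coefCM coefXM /=.
    rewrite !coef_egfX_eq0 ?mulr0 ?addr0 ?mulr0 //; lia.
  move=> k /andP[k0 _]; rewrite /dt (coef_GX_d_egf n0) // -/G' -/e.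
  have -> : f k.+1 = - (n`!%:R * (-1) ^+ k * p ^- k / p *
      (e * (G' ^+ k)`_n`_k.-1 + w 1 0 x * (G' ^+ k)`_n`_k)).
    rewrite /f /= coefCM coefXM gtn_eqF // -!exprVn !exprS; ring.
  have -> : p ^- k.+1 = p ^- k / p by rewrite -!exprVn exprS mulrC.
  rewrite /f factS natrM -/p rE -/p.
  have : k%:R != 0 :> R by rewrite pnatr_eq0 -lt0n.
  move: (('X%:P * G' ^+ k.-1)`_n`_k.-1) ((G' ^+ k.-1)`_n`_k.-1).
  move: ((G' ^+ k)`_n.+1`_k.-1) => c a b.
  move: ((G' ^+ k)`_n`_k.-1) ((G' ^+ k)`_n`_k) (p ^- k) ((-1) ^+ k : R).
  move: n`!%:R => f1 a1 b1 c1 e1 k1.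
  rewrite -[_ 0 1 x]/p in p0 *.
  by field; rewrite p0 k1.
apply: is_derive_ext => [t|]; first exact/esym/implicit_sum_widen.
apply: is_derive_sumR => k _.
have h1 := is_derive_exprVn k (dw 0 1 n0) p0.
have := is_derive_polyX k (is_derive_egf n0 dw) n k.-1.
move/(is_derive_scal _ _ (n`!%:R / k%:R)) => h2.
have := is_derive_scal _ _ ((-1) ^+ k) _ (is_derive_mulR h1 h2).
rewrite /dt -/p -/e /G' -(coef_GX n w x k) => h.
by apply: is_derive_ext h => t; rewrite !RmultE mulrA.
Qed.

(** * Induction on the order of the derivative *)

Theorem theorem2 (n : nat) (hn : (1 <= n)%N)
    (U : R * R -> Prop) (hU : open U)
    (F : R -> R -> R) (hF : C_n_on n U F)
    (a b : Rbar) (y : R -> R)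
    (hy : forall x : R, Rbar_lt a x -> Rbar_lt x b -> ex_derive y x)
    (hyU : forall x : R, Rbar_lt a x -> Rbar_lt x b -> U (x, y x))
    (hFy0 : forall x : R, Rbar_lt a x -> Rbar_lt x b -> F x (y x) = 0)
    (hFy : forall x : R, Rbar_lt a x -> Rbar_lt x b ->
             partial_derive 0 1 F x (y x) <> 0) :
  forall x : R, Rbar_lt a x -> Rbar_lt x b ->
    (forall m : nat, (m <= n)%N -> ex_derive_n y m x) /\
    Derive_n y n x =
      \sum_(1 <= k < 2 * n)
        (-1) ^+ k * (partial_derive 0 1 F x (y x)) ^- k * I_poly F n k x (y x).
Proof.
pose w i j t := partial_derive i j F t (y t).
pose r x := Derive y x.
have dw (x : R) i j : Rbar_lt a x -> Rbar_lt x b -> (i + j < n)%N ->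
    is_derive (w i j) x (w i.+1 j x + r x * w i j.+1 x).
  move=> ax xb ij; apply: is_derive_partial_curve ij _; last first.
    by rewrite /r; apply: Derive_correct; apply: hy.
  by apply: filter_imp (hU _ (hyU x ax xb)) => -[u v]; apply: hF.
have p0 (x : R) : Rbar_lt a x -> Rbar_lt x b -> w 0 1 x != 0.
  by move=> ax xb; apply/eqP/hFy.
(* Differentiate F(x, y(x)) = 0, which holds near x. *)
have rE (x : R) : Rbar_lt a x -> Rbar_lt x b -> r x = - w 1 0 x / w 0 1 x.
  move=> ax xb; have := is_derive_unique _ _ _ (dw x 0 0 ax xb hn).
  rewrite (Derive_ext_loc _ (fun=> 0)); last first.
    exact: locally_interval ax xb hFy0.
  rewrite Derive_const => /esym/eqP; rewrite addrC addr_eq0 => /eqP <-.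
  by rewrite mulfK ?p0.
have main m : (0 < m <= n)%N -> forall x : R, Rbar_lt a x -> Rbar_lt x b ->
    ex_derive_n y m x /\ Derive_n y m x = implicit_sum m (fun i j => w i j x).
  elim: m => // -[_ _|m IHm /andP[_ mn]] x ax xb.
    split; first exact: hy.
    rewrite /implicit_sum big_nat1 expr1 coef_egf /cut01 /=.
    rewrite -[LHS]/(r x) rE // -[1`!]/1%N fact0 muln1 !divr1 mul1r expr1.
    by rewrite mulN1r !mulNr mulrC.
  have dm := is_derive_implicit_sum (n := m.+1) isT _ (p0 x ax xb) (rE x ax xb).
  have {}dm : is_derive (Derive_n y m.+1) x
      (implicit_sum m.+2 (fun i j => w i j x)).
    (* The induction hypothesis holds on the whole open interval, so both functions agree near x. *)
    apply: is_derive_ext_loc (dm _) => [|i j ij].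
      apply: locally_interval ax xb _ => t ta tb; apply/esym.
      by have [] := IHm (ltnW mn) t ta tb.
    by apply: dw => //; apply: leq_ltn_trans mn.
  by split; [eexists; exact: dm | exact: is_derive_unique].
move=> x ax xb; split.
  by move=> [|m] mn //; have [] := main m.+1 mn x ax xb.
have [|_ ->] := main n _ x ax xb; first by rewrite hn leqnn.
apply: eq_big_nat => k /andP[k0 _].
by rewrite I_poly_egf.
Qed.
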